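(* Let $H$ be a closed normal subgroup of a topological group $G$. Assume that there is a continuous left-invariant pseudometric $\partial$ on $G$ such that $\partial\upharpoonright H$ induces the restriction of $\mathcal E_L(G)$ to $H$, i.e., such that $$\mathcal E_\partial(G)\upharpoonright H=\mathcal E_L(G)\upharpoonright H.$$ Then the left coarse structure on $G/H$ equals the quotient of the left coarse structure on $G$, that is, $$\mathcal E_q(G/H)=\mathcal E_L(G/H)=\mathcal E_{\rm Haus}(G/H).$$
   Context: A coarse structure on a set $X$ is an ideal $\mathcal E$ of subsets of $X\times X$ (closed under subsets and finite unions) containing the diagonal and closed under transposition $E\mapsto E^{\sf T}$ and composition $E\circ F=\{(x,z): \exists y\ (x,y)\in E,\ (y,z)\in F\}$. A pseudometric $d$ on $X$ induces the coarse structure $\mathcal E_d(X)=\{E\subseteq X\times X:\sup_{(x,y)\in E}d(x,y)<\infty\}$. For $Y\subseteq X$, the restriction is $\mathcal E\upharpoonright Y=\{E\in\mathcal E: E\subseteq Y\times Y\}$. A map $\phi\colon(X,\mathcal E)\to(Y,\mathcal F)$ is controlled if $(\phi\times\phi)[E]\in\mathcal F$ for all $E\in\mathcal E$. For a topological group $G$, the left coarse structure is $\mathcal E_L(G)=\bigcap_d\mathcal E_d(G)$, where $d$ ranges over all continuous left-invariant pseudometrics on $G$. If $H$ is a closed normal subgroup with quotient map $\pi\colon G\to G/H$, $\mathcal E_L(G/H)$ is the left coarse structure of the topological quotient group $G/H$; $\mathcal E_q(G/H)$ is the smallest coarse structure on $G/H$ making $\pi\colon (G,\mathcal E_L(G))\to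 G/H$ controlled; and $\mathcal E_{\rm Haus}(G/H)=\bigcap_d\mathcal E_{d_{\rm Haus}}(G/H)$, where $d$ ranges over the continuous left-invariant pseudometrics on $G$ and $d_{\rm Haus}$ is the Hausdorff distance between cosets with respect to $d$, which satisfies $d_{\rm Haus}(Hg,Hf)=\inf_{h\in H}d(hg,f)$. *)

(* Defs.v *)
From HB Require Import structures.
From mathcomp Require Import all_boot all_order all_algebra.
From mathcomp Require Import all_classical all_reals.
From mathcomp Require Import ereal topology normedtype.

Set Implicit Arguments.
Unset Strict Implicit.
Unset Printing Implicit Defensive.

Import Order.TTheory GRing.Theory Num.Theory.
Import numFieldNormedType.Exports.

Local Open Scope classical_set_scope.
Local Open Scope group_scope.
Local Open Scope quotient_scope.

HB.mixin Record isTopologicalGroup G & Group G & Topological G := {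
  mulg_continuous : continuous (fun p : G * G => p.1 * p.2) ;
  invg_continuous : continuous (fun x : G => x^-1)
}.

(* No separation axiom is imposed. *)
#[short(type="topologicalGroupType")]
HB.structure Definition TopologicalGroup :=
  {G of Group G & Topological G & isTopologicalGroup G}.

HB.mixin Record isConjgClosed (G : groupType) (H : {pred G}) := {
  gpredJ_subproof : {in H, forall x g, x ^ g \in H}
}.

#[short(type="normalSubgroup")]
HB.structure Definition NormalSubgroup (G : groupType) :=
  {H of GroupClosed G H & isConjgClosed G H}.

Section QuotientGroup.
Context {G : topologicalGroupType} (H : normalSubgroup G).
Implicit Types x y g : G.

(* H x = H y; membership in [H] is boolean, as for any [{pred G}], which
   classically is no restriction. *)
Definition coset_rel : rel G := fun x y => x * y^-1 \in H.

Lemma gpredJ x g : x \in H -> x ^ g \in H.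
Proof. by move=> /gpredJ_subproof. Qed.

Lemma coset_rel_equiv : equiv_class_of coset_rel.
Proof.
split=> [x|x y|y x z]; rewrite /coset_rel.
- by rewrite mulgV gpred1.
- by rewrite -(gpredV H (x * y^-1)) invgM invgK.
- move=> xy yz; suff -> : x * z^-1 = (x * y^-1) * (y * z^-1) by exact: gpredM.
  by rewrite -mulgA mulKg.
Qed.

Canonical coset_equiv := EquivRelPack coset_rel_equiv.

Definition quotient_group : Type := quotient_topology {eq_quot coset_rel}.

HB.instance Definition _ := Quotient.on quotient_group.
HB.instance Definition _ := Topological.on quotient_group.

(* g |-> Hg *)
Definition coset : G -> quotient_group := \pi_quotient_group.

Lemma repr_cosetK : cancel repr coset.
Proof. exact: reprK. Qed.

Lemma coset_eqP x y : reflect (coset x = coset y) (x * y^-1 \in H).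
Proof. exact: (@eqmodP _ coset_equiv x y). Qed.

Definition quotient_one : quotient_group := coset 1.
Definition quotient_mul (a b : quotient_group) : quotient_group :=
  coset (repr a * repr b).
Definition quotient_inv (a : quotient_group) : quotient_group :=
  coset (repr a)^-1.

Lemma repr_cosetP x : repr (coset x) * x^-1 \in H.
Proof. by apply/coset_eqP; rewrite repr_cosetK. Qed.

Lemma quotient_mulE x y : quotient_mul (coset x) (coset y) = coset (x * y).
Proof.
rewrite /quotient_mul; apply/coset_eqP; set x' := repr _; set y' := repr _.
have -> : x' * y' * (x * y)^-1 = (y' * y^-1) ^ x'^-1 * (x' * x^-1).
  by rewrite conjgE invgK invgM -!mulgA mulKg.
by rewrite gpredM ?gpredJ ?repr_cosetP.
Qed.

Lemma quotient_invE x : quotient_inv (coset x) = coset x^-1.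
Proof.
rewrite /quotient_inv; apply/coset_eqP; set x' := repr _.
have -> : x'^-1 * x^-1^-1 = (x' * x^-1)^-1 ^ x'.
  by rewrite conjgE invgM !invgK -!mulgA mulVg mulg1.
by rewrite gpredJ // gpredV repr_cosetP.
Qed.

Lemma quotient_ind (P : quotient_group -> Prop) :
  (forall x, P (coset x)) -> forall a, P a.
Proof. by move=> Pcoset a; rewrite -[a]repr_cosetK. Qed.

Lemma quotient_mulA : associative quotient_mul.
Proof.
elim/quotient_ind=> x; elim/quotient_ind=> y; elim/quotient_ind=> z.
by rewrite !quotient_mulE mulgA.
Qed.

Lemma quotient_mul1 : left_id quotient_one quotient_mul.
Proof. by elim/quotient_ind=> x; rewrite quotient_mulE mul1g. Qed.

Lemma quotient_mulr1 : right_id quotient_one quotient_mul.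
Proof. by elim/quotient_ind=> x; rewrite quotient_mulE mulg1. Qed.

Lemma quotient_mulV : left_inverse quotient_one quotient_inv quotient_mul.
Proof. by elim/quotient_ind=> x; rewrite quotient_invE quotient_mulE mulVg. Qed.

Lemma quotient_mulVr : right_inverse quotient_one quotient_inv quotient_mul.
Proof. by elim/quotient_ind=> x; rewrite quotient_invE quotient_mulE mulgV. Qed.

HB.instance Definition _ := isGroup.Build quotient_group quotient_mulA
  quotient_mul1 quotient_mulr1 quotient_mulV quotient_mulVr.

Lemma cosetM : {morph coset : x y / x * y}.
Proof. by move=> x y; rewrite -quotient_mulE. Qed.

Lemma cosetV : {morph coset : x / x^-1}.
Proof. by move=> x; rewrite -quotient_invE. Qed.

Lemma open_coset (U : set G) : open U -> open (coset @` U).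
Proof.
move=> oU.
have -> : open (coset @` U) =
    open (coset @^-1` (coset @` U)) by [].
have -> : coset @^-1` (coset @` U) =
    \bigcup_(h in [set` H]) ((fun x => h * x) @^-1` U).
  apply/seteqP; split=> x /=.
    case=> u Uu /coset_eqP ux; exists (u * x^-1) => //=.
    by rewrite -mulgA mulVg mulg1.
  case=> h /= hH Uhx; exists (h * x) => //; apply/coset_eqP.
  by rewrite -mulgA mulgV mulg1.
apply: bigcup_open => h _; apply: open_comp => // x _.
exact: (cvg_comp2 (cvg_cst _) cvg_id (mulg_continuous (_, _))).
Qed.

Lemma quotient_mulg_continuous :
  continuous (fun p : quotient_group * quotient_group => p.1 * p.2).
Proof.
case; elim/quotient_ind=> x; elim/quotient_ind=> y A /=.
rewrite -cosetM => /(@pi_continuous G {eq_quot coset_rel} (x * y)).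
move=> /(mulg_continuous (x, y))[[U V]] /= [].
rewrite (nbhsE x) (nbhsE y) => -[U' [oU' U'x] U'U] [V' [oV' V'y] V'V] UVA.
have nC W z : open W -> W z -> nbhs (coset z) (coset @` W).
  by move=> oW Wz; apply: open_nbhs_nbhs; split; [exact: open_coset | exists z].
exists (coset @` U', coset @` V'); first by split; exact: nC.
move=> [_ _] /= [[u U'u <-] [v V'v <-]]; rewrite -cosetM.
by apply: (UVA (u, v)); split; [exact: U'U | exact: V'V].
Qed.

Lemma quotient_invg_continuous : continuous (fun a : quotient_group => a^-1).
Proof.
apply/(@quotient_continuous G {eq_quot coset_rel}) => x.
rewrite (_ : _ \o _ = coset \o (fun y : G => y^-1)); last first.
  by apply/funext => y; rewrite /= -cosetV.
apply: continuous_comp; first exact: invg_continuous.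
exact: (@pi_continuous G {eq_quot coset_rel}).
Qed.

HB.instance Definition _ := isTopologicalGroup.Build quotient_group
  quotient_mulg_continuous quotient_invg_continuous.

End QuotientGroup.

Section CoarseStructures.
Local Open Scope relation_scope.
Context {X Y : Type}.

Record coarse_structure (E : set (set (X * X))) : Prop := {
  coarse_diag : E diagonal ;
  coarse_sub : forall A B, A `<=` B -> E B -> E A ;
  coarse_setU : forall A B, E A -> E B -> E (A `|` B) ;
  coarse_inv : forall A, E A -> E A^-1 ;
  (* [B \; A] relates x to z when A (x, y) and B (y, z) for some y *)
  coarse_comp : forall A B, E A -> E B -> E (B \; A)
}.

Definition coarse_restrict (E : set (set (X * X))) (Z : set X) :
    set (set (X * X)) := [set A | E A /\ A `<=` Z `*` Z].

Definition controlled (E : set (set (X * X))) (F : set (set (Y * Y)))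
    (phi : X -> Y) : Prop :=
  forall A, E A -> F ((fun p => (phi p.1, phi p.2)) @` A).

End CoarseStructures.

(* The smallest coarse structure on Y making phi : (X, E) -> Y controlled. *)
Definition image_coarse {X Y : Type} (E : set (set (X * X))) (phi : X -> Y) :
    set (set (Y * Y)) :=
  \bigcap_(F in [set F | coarse_structure F /\ controlled E F phi]) F.

Section PseudometricCoarse.
Context {R : realType}.
Local Open Scope ereal_scope.

Record pseudometric {X : Type} (d : X -> X -> R) : Prop := {
  pdist_ge0 : forall x y, (0 <= d x y)%R ;
  pdistxx : forall x, d x x = 0%R ;
  pdist_sym : forall x y, d x y = d y x ;
  pdist_triangle : forall x y z, (d x z <= d x y + d y z)%R
}.

(* [d] is extended-real valued because Hausdorff distances a priori are; a real
   pseudometric is composed with [EFin]. For [E = set0] the supremum is -oo. *)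
Definition dist_coarse {X : Type} (d : X -> X -> \bar R) : set (set (X * X)) :=
  [set E | ereal_sup [set d p.1 p.2 | p in E] < +oo].

Definition pdist_coarse {X : Type} (d : X -> X -> R) : set (set (X * X)) :=
  dist_coarse (fun x y => (d x y)%:E).

Definition hausdorff_dist {X : Type} (d : X -> X -> R) (A B : set X) : \bar R :=
  maxe (ereal_sup [set ereal_inf [set (d a b)%:E | b in B] | a in A])
       (ereal_sup [set ereal_inf [set (d a b)%:E | a in A] | b in B]).

End PseudometricCoarse.

Section LeftCoarse.
Variable R : realType.

Definition left_invariant {G : topologicalGroupType} (d : G -> G -> R) : Prop :=
  forall g x y, d (g * x) (g * y) = d x y.

Definition continuous_left_pseudometric {G : topologicalGroupType} :
    set (G -> G -> R) :=
  [set d | [/\ pseudometric d, left_invariant d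
             & continuous (fun p : G * G => d p.1 p.2)]].

Definition left_coarse (G : topologicalGroupType) : set (set (G * G)) :=
  \bigcap_(d in continuous_left_pseudometric) pdist_coarse d.

Arguments left_coarse : clear implicits.

Context {G : topologicalGroupType} (H : normalSubgroup G).

Definition quotient_coarse : set (set (quotient_group H * quotient_group H)) :=
  image_coarse (left_coarse G) (coset H).

(* The elements of the coset [a], as a subset of G. *)
Definition coset_set (a : quotient_group H) : set G := coset H @^-1` [set a].

Definition hausdorff_coarse : set (set (quotient_group H * quotient_group H)) :=
  \bigcap_(d in continuous_left_pseudometric)
    dist_coarse (fun a b => hausdorff_dist d (coset_set a) (coset_set b)).

Lemma coset_setE g : coset_set (coset H g) = [set h * g | h in [set` H]].
Proof.
apply/seteqP; split=> x /=.
  by move=> /coset_eqP xg; exists (x * g^-1); rewrite // -mulgA mulVg mulg1.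
by case=> h /= hH <-; apply/coset_eqP; rewrite -mulgA mulgV mulg1.
Qed.

Lemma hausdorff_distE (d : G -> G -> R) g f :
  pseudometric d -> left_invariant d ->
  hausdorff_dist d (coset_set (coset H g)) (coset_set (coset H f)) =
  ereal_inf [set (d (h * g)%g f)%:E | h in [set` H]].
Proof.
move=> pd ld; rewrite /hausdorff_dist !coset_setE.
have E1 h : h \in H ->
    ereal_inf [set (d (h * g)%g b)%:E | b in [set k * f | k in [set` H]]] =
    ereal_inf [set (d (k * g)%g f)%:E | k in [set` H]].
  move=> hH; congr ereal_inf; apply/seteqP; split=> t [] /=.
    move=> _ [k kH <-] <-; exists (k^-1 * h);
      first by rewrite /= gpredM ?gpredV.
    by rewrite -(ld k) !mulgA mulgV mul1g.
  move=> k kH <-; exists (h * k^-1 * f).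
    by exists (h * k^-1); rewrite //= gpredM ?gpredV.
  by rewrite -(ld (h * k^-1) (k * g)) [h * _ * (k * g)]mulgA mulgVK.
have E2 h : h \in H ->
    ereal_inf [set (d a (h * f)%g)%:E | a in [set k * g | k in [set` H]]] =
    ereal_inf [set (d (k * g)%g f)%:E | k in [set` H]].
  move=> hH; congr ereal_inf; apply/seteqP; split=> t [] /=.
    move=> _ [k kH <-] <-; exists (h^-1 * k);
      first by rewrite /= gpredM ?gpredV.
    by rewrite -(ld h) !mulgA mulgV mul1g.
  move=> k kH <-; exists (h * k * g);
    first by exists (h * k); rewrite //= gpredM.
  by rewrite -mulgA ld.
set I := ereal_inf _.
have S1 (F : G -> \bar R) g' : (forall h, h \in H -> F (h * g') = I) ->
    ereal_sup [set F a | a in [set k * g' | k in [set` H]]] = I.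
  move=> FI; rewrite (_ : [set _ | _ in _] = [set I]) ?ereal_sup1 //.
  apply/seteqP; split=> t.
    by move=> [_ [h hH <-] <-]; rewrite /= FI.
  move=> ->; exists (1 * g'); last by rewrite FI ?gpred1.
  by exists 1; rewrite //= gpred1.
by rewrite (S1 _ g E1) (S1 _ f E2) maxxx.
Qed.

End LeftCoarse.

Arguments continuous_left_pseudometric R {G}.
Arguments left_coarse : clear implicits.
Arguments quotient_coarse R {G} H.
Arguments hausdorff_coarse R {G} H.

(* Main.v *)
(* The second equality needs no hypothesis: Hausdorff distances are continuous
   left-invariant pseudometrics on G/H, and a pseudometric on G/H is the
   Hausdorff distance of its pullback to G. For the first one, pairs at bounded
   Hausdorff distance must be lifted to G so that one lift works for all
   pseudometrics at once: choose it close for the given pseudometric, and use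
   the hypothesis on H to control all the others. *)
Require Import Defs.
From mathcomp Require Import all_boot all_order all_algebra.
From mathcomp Require Import all_classical all_reals.
From mathcomp Require Import ereal topology normedtype.
From mathcomp Require Import lra.

Set Implicit Arguments.
Unset Strict Implicit.
Unset Printing Implicit Defensive.

Import Order.TTheory GRing.Theory Num.Theory.
Import numFieldNormedType.Exports.

Local Open Scope classical_set_scope.

(** * Coarse structures given by bounded distance *)

Lemma dist_coarseP {R : realType} {X : Type} (d : X -> X -> \bar R)
    (A : set (X * X)) :
  dist_coarse d A <-> exists M : R, forall x y, A (x, y) -> (d x y <= M%:E)%E.
Proof.
rewrite /dist_coarse /=; split=> [|[M dM]].
  set S := [set _ | _ in _]; rewrite ltey_eq => supS.
  (* When the supremum is -oo, [fine] returns the default 0, still an upper bound. *)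
  exists (fine (ereal_sup S)) => x y Axy.
  have le_sup : (d x y <= ereal_sup S)%E.
    by apply: ereal_sup_ubound; exists (x, y).
  case/orP: supS => [fin|/eqP supN]; first by rewrite fineK.
  by rewrite (le_trans le_sup) // supN leNye.
apply: (@le_lt_trans _ _ M%:E); last exact: ltry.
by apply: ge_ereal_sup => _ [[x y] Axy <-]; exact: dM.
Qed.

Lemma pdist_coarseP {R : realType} {X : Type} (d : X -> X -> R)
    (A : set (X * X)) :
  pdist_coarse d A <-> exists M : R, forall x y, A (x, y) -> (d x y <= M)%R.
Proof.
by split=> [/dist_coarseP|] [M dM]; [|apply/dist_coarseP];
  exists M => x y /dM; rewrite lee_fin.
Qed.

Lemma pdist_coarse_structure {R : realType} {X : Type} (d : X -> X -> R) :
  pseudometric d -> coarse_structure (pdist_coarse d).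
Proof.
move=> pd; split=> [|A B AB|A B|A|A B].
- apply/pdist_coarseP; exists 0%R => x y; rewrite /diagonal /= => ->.
  by rewrite (pdistxx pd).
- move=> /pdist_coarseP[M dM]; apply/pdist_coarseP.
  by exists M => x y /AB /dM.
- move=> /pdist_coarseP[M dM] /pdist_coarseP[N dN]; apply/pdist_coarseP.
  by exists (Num.max M N) => x y [/dM|/dN]; rewrite le_max => ->; rewrite ?orbT.
- move=> /pdist_coarseP[M dM]; apply/pdist_coarseP.
  by exists M => x y /dM; rewrite (pdist_sym pd).
- move=> /pdist_coarseP[M dM] /pdist_coarseP[N dN]; apply/pdist_coarseP.
  exists (M + N)%R => x z [y /= xy yz].
  by have := pdist_triangle pd x y z; have := dM _ _ xy; have := dN _ _ yz; lra.
Qed.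

Lemma bigcap_coarse_structure {X I : Type} (P : set I)
    (F : I -> set (set (X * X))) :
  (forall i, P i -> coarse_structure (F i)) ->
  coarse_structure (\bigcap_(i in P) F i).
Proof.
move=> FP; split=> [i Pi|A B AB FB i Pi|A B FA FB i Pi|A FA i Pi|A B FA FB i Pi].
- exact: coarse_diag (FP i Pi).
- exact: (coarse_sub (FP i Pi)) AB (FB i Pi).
- exact: (coarse_setU (FP i Pi)) (FA i Pi) (FB i Pi).
- exact: (coarse_inv (FP i Pi)) (FA i Pi).
- exact: (coarse_comp (FP i Pi)) (FA i Pi) (FB i Pi).
Qed.

Lemma left_coarse_structure (R : realType) (G : topologicalGroupType) :
  coarse_structure (left_coarse R G).
Proof.
by apply: bigcap_coarse_structure => d [pd _ _]; exact: pdist_coarse_structure.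
Qed.

(** Serves to find one point that is close for two pseudometrics at once. *)
Lemma continuous_left_pseudometricD (R : realType) (G : topologicalGroupType)
    (d e : G -> G -> R) :
  continuous_left_pseudometric R d -> continuous_left_pseudometric R e ->
  continuous_left_pseudometric R (fun x y => d x y + e x y)%R.
Proof.
move=> [pd ld cd] [pe le ce]; split.
- split=> [x y|x|x y|x y z].
  + by rewrite addr_ge0 ?(pdist_ge0 pd) ?(pdist_ge0 pe).
  + by rewrite (pdistxx pd) (pdistxx pe) addr0.
  + by rewrite (pdist_sym pd) (pdist_sym pe).
  + by have := pdist_triangle pd x y z; have := pdist_triangle pe x y z; lra.
- by move=> g x y; rewrite ld le.
- by move=> p; apply: cvgD; [exact: cd|exact: ce].
Qed.

(** * Pseudometrics pulled back along the quotient map *)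

Section Quotient.
Context {R : realType} {G : topologicalGroupType} (H : normalSubgroup G).

Lemma coset_continuous : continuous (coset H).
Proof. exact: (@pi_continuous G _). Qed.

Lemma coset_mull h g : h \in H -> coset H (h * g)%g = coset H g.
Proof. by move=> hH; apply/coset_eqP; rewrite mulgK. Qed.

Lemma pullback_continuous_left_pseudometric
    (D : quotient_group H -> quotient_group H -> R) :
  continuous_left_pseudometric R D ->
  continuous_left_pseudometric R (fun x y => D (coset H x) (coset H y)).
Proof.
move=> [pD lD cD]; split.
- split=> [x y|x|x y|x y z].
  + exact: pdist_ge0 pD _ _.
  + exact: pdistxx pD _.
  + exact: pdist_sym pD _ _.
  + exact: pdist_triangle pD _ _ _.
- by move=> g x y; rewrite !cosetM lD.
- move=> [x y]; apply: (cvg_comp2 _ _ (cD (coset H x, coset H y))).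
  + by apply: cvg_comp; [exact: cvg_fst | exact: coset_continuous].
  + by apply: cvg_comp; [exact: cvg_snd | exact: coset_continuous].
Qed.

(** * The Hausdorff pseudometric on the quotient group *)

Section HausdorffPseudometric.
Variable d : G -> G -> R.
Hypotheses (pd : pseudometric d) (ld : left_invariant d).

(** The distance between cosets is always finite ([hausdorff_dist_fin]), so [fine] loses nothing. *)
Definition coset_dist (a b : quotient_group H) : R :=
  fine (hausdorff_dist d (coset_set a) (coset_set b)).

Lemma hausdorff_dist_fin g f :
  hausdorff_dist d (coset_set (coset H g)) (coset_set (coset H f)) \is a fin_num.
Proof.
rewrite hausdorff_distE // ge0_fin_numE.
  apply: (@le_lt_trans _ _ (d (1 * g)%g f)%:E); last exact: ltry.
  by apply: ereal_inf_lbound; exists 1%g; rewrite //= gpred1.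
by apply: le_ereal_inf_tmp => _ [h _ <-]; rewrite lee_fin (pdist_ge0 pd).
Qed.

Lemma coset_distE a b :
  (coset_dist a b)%:E = hausdorff_dist d (coset_set a) (coset_set b).
Proof.
elim/(@quotient_ind _ H): a => g; elim/(@quotient_ind _ H): b => f.
by rewrite /coset_dist fineK ?hausdorff_dist_fin.
Qed.

Lemma coset_dist_le g f : (coset_dist (coset H g) (coset H f) <= d g f)%R.
Proof.
rewrite -lee_fin coset_distE hausdorff_distE //; apply: ereal_inf_lbound.
by exists 1%g; rewrite ?mul1g //= gpred1.
Qed.

(** The infimum over [H] need not be attained, hence the slack [e]. *)
Lemma coset_dist_adherent g f e : (0 < e)%R ->
  exists2 h, h \in H & (d (h * g)%g f < coset_dist (coset H g) (coset H f) + e)%R.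
Proof.
move=> e0; have := hausdorff_dist_fin g f.
rewrite hausdorff_distE // => /(lb_ereal_inf_adherent e0)[_ [h hH <-]].
by rewrite -hausdorff_distE // -coset_distE -EFinD lte_fin; exists h.
Qed.

Lemma coset_dist_lb g f m :
  (forall h, h \in H -> (m <= d (h * g)%g f)%R) ->
  (m <= coset_dist (coset H g) (coset H f))%R.
Proof.
move=> lb; apply/ler_addgt0Pr => e /(coset_dist_adherent g f)[h hH].
by have := lb h hH; lra.
Qed.

Lemma coset_dist_pseudometric : pseudometric coset_dist.
Proof.
split=> [a b|a|a b|a b c].
- elim/(@quotient_ind _ H): a => g; elim/(@quotient_ind _ H): b => f.
  by apply: coset_dist_lb => h _; exact: pdist_ge0 pd _ _.
- elim/(@quotient_ind _ H): a => g; apply/eqP; rewrite eq_le; apply/andP; split.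
    by rewrite -(pdistxx pd g) coset_dist_le.
  by apply: coset_dist_lb => h _; exact: pdist_ge0 pd _ _.
- wlog suff le : a b / (coset_dist a b <= coset_dist b a)%R.
    by apply/eqP; rewrite eq_le !le.
  elim/(@quotient_ind _ H): a => g; elim/(@quotient_ind _ H): b => f.
  apply: coset_dist_lb => h hH.
  (* The point [h * f] represents the same coset as [f]. *)
  by rewrite -(coset_mull f hH) (pdist_sym pd) coset_dist_le.
- elim/(@quotient_ind _ H): a => x; elim/(@quotient_ind _ H): b => y.
  elim/(@quotient_ind _ H): c => z; apply/ler_addgt0Pr => e e0.
  have e20 : (0 < e / 2)%R by rewrite divr_gt0.
  have [h hH dh] := coset_dist_adherent x y e20.
  have [k kH dk] := coset_dist_adherent y z e20.
  (* Left translation by [k] preserves the distance from [h * x] to [y] and moves [y] to [k * y],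
     the point close to [z]; the two estimates can then be chained. *)
  have := coset_dist_le (k * (h * x))%g z; rewrite !coset_mull //.
  have := pdist_triangle pd (k * (h * x))%g (k * y)%g z; rewrite ld.
  lra.
Qed.

Lemma coset_dist_left_invariant : left_invariant coset_dist.
Proof.
(* One inequality for all [u] suffices: applied to [u^-1] it gives the converse. *)
have le u a b : (coset_dist (u * a)%g (u * b)%g <= coset_dist a b)%R.
  elim/(@quotient_ind _ H): u => u; elim/(@quotient_ind _ H): a => x.
  elim/(@quotient_ind _ H): b => y; apply: coset_dist_lb => h hH.
  by rewrite -(coset_mull x hH) -!cosetM (le_trans (coset_dist_le _ _)) ?ld.
move=> u a b; apply/eqP; rewrite eq_le le /=.
by have := le (u^-1)%g (u * a)%g (u * b)%g; rewrite !mulKg.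
Qed.

Lemma coset_dist_continuous :
  continuous (fun p : G * G => d p.1 p.2) ->
  continuous (fun p : quotient_group H * quotient_group H => coset_dist p.1 p.2).
Proof.
move=> cd [a0 b0].
(* The map [coset] is open and does not increase distances, so it sends a small open neighbourhood
   of [x] to a small one of its coset. *)
have near0 a e : (0 < e)%R -> \forall b \near a, (coset_dist a b < e)%R.
  elim/(@quotient_ind _ H): a => x e0.
  have : \forall y \near x, (d x y < e)%R.
    have cdx : d x y @[y --> x] --> d x x.
      exact: (cvg_comp2 (cvg_cst _) cvg_id (cd (x, x))).
    by apply: (cdx [set t | t < e]%R); rewrite (pdistxx pd); exact: lt_nbhsl.
  rewrite /prop_near1 nbhsE => -[U [oU Ux] Ue].
  apply: (@filterS _ _ _ (coset H @` U)).
    by move=> _ [y Uy <-]; exact: le_lt_trans (coset_dist_le _ _) (Ue _ Uy).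
  by apply: open_nbhs_nbhs; split; [exact: open_coset | exists x].
apply/cvgrPdist_lt => e e0; have e20 : (0 < e / 2)%R by rewrite divr_gt0.
exists ([set a | coset_dist a0 a < e / 2]%R, [set b | coset_dist b0 b < e / 2]%R).
  by split; exact: near0.
case=> a b [/= ha hb]; rewrite ltr_norml.
have pD := coset_dist_pseudometric.
(* Writing D for [coset_dist d], these give |D(a0,b0) - D(a,b)| <= D(a0,a) + D(b0,b). *)
have := pdist_triangle pD a0 a b0; have := pdist_triangle pD a b b0.
have := pdist_triangle pD a a0 b; have := pdist_triangle pD a0 b0 b.
rewrite (pdist_sym pD a a0) (pdist_sym pD b b0); lra.
Qed.

End HausdorffPseudometric.

Lemma coset_dist_continuous_left_pseudometric (d : G -> G -> R) :
  continuous_left_pseudometric R d ->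
  continuous_left_pseudometric R (coset_dist d).
Proof.
move=> [pd ld cd]; split.
- exact: coset_dist_pseudometric.
- exact: coset_dist_left_invariant.
- exact: coset_dist_continuous.
Qed.

(** * Comparison of the three coarse structures *)

Lemma left_coarse_quotient :
  left_coarse R (quotient_group H) = hausdorff_coarse R H.
Proof.
apply/seteqP; split=> A LA.
  move=> d dP; have [pd ld _] := dP.
  have /pdist_coarseP[M dM] := LA _ (coset_dist_continuous_left_pseudometric dP).
  by apply/dist_coarseP; exists M => a b Aab; rewrite -coset_distE // lee_fin dM.
move=> D /[dup] DP [pD lD _].
have dP := pullback_continuous_left_pseudometric DP; have [pd ld _] := dP.
have /dist_coarseP[M dM] := LA _ dP.
apply/pdist_coarseP; exists M => a b /dM; rewrite -coset_distE // lee_fin.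
(* The pullback is constant on pairs of cosets, so every term of the infimum equals [D a b]. *)
apply: le_trans; elim/(@quotient_ind _ H): a => x; elim/(@quotient_ind _ H): b => y.
by apply: coset_dist_lb => // h hH; rewrite coset_mull.
Qed.

(** By minimality it is enough that [coset] is controlled, and this follows by pulling back each
    pseudometric [D] to [G]. *)
Lemma quotient_coarse_sub_left :
  quotient_coarse R H `<=` left_coarse R (quotient_group H).
Proof.
move=> A; apply; split; first exact: left_coarse_structure.
move=> B LB D /pullback_continuous_left_pseudometric /LB /pdist_coarseP[M dM].
by apply/pdist_coarseP; exists M => _ _ [[x y] /dM + [<- <-]].
Qed.

(* Each pair of cosets related by A lifts to a pair at d-distance at most C.
   These lifts are bounded for every other e: comparing x with a point h x that
   is close to y for d + e, the element x^-1 h x of H is d-bounded, hence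
   e-bounded by hypothesis. *)
Lemma hausdorff_coarse_sub_quotient (d : G -> G -> R) :
  continuous_left_pseudometric R d ->
  coarse_restrict (pdist_coarse d) [set` H] `<=`
    coarse_restrict (left_coarse R G) [set` H] ->
  hausdorff_coarse R H `<=` quotient_coarse R H.
Proof.
move=> dP dH A HA F [cF ctF].
have bound e (eP : continuous_left_pseudometric R e) : exists C : R,
    forall x y, A (coset H x, coset H y) ->
    exists2 h, h \in H & (e (h * x)%g y < C)%R.
  have [pe le _] := eP; have /dist_coarseP[M eM] := HA _ eP.
  exists (M + 1)%R => x y /eM; rewrite -coset_distE // lee_fin => leM.
  by have [h hH] := coset_dist_adherent pe le x y ltr01; exists h => //; lra.
have [pd ld _] := dP; have [C dC] := bound d dP.
(* [B] depends on [d] alone; its image contains [A], so it remains to bound it for every [e]. *)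
pose B : set (G * G) :=
  [set p | A (coset H p.1, coset H p.2) /\ (d p.1 p.2 <= C)%R].
apply: (@coarse_sub _ _ cF _ ((fun p => (coset H p.1, coset H p.2)) @` B)).
  case=> a b; elim/(@quotient_ind _ H): a => x; elim/(@quotient_ind _ H): b => y.
  move=> Axy.
  have [h hH dh] := dC x y Axy; exists ((h * x)%g, y); last by rewrite /= coset_mull.
  by split; rewrite /= ?coset_mull ?ltW.
apply: ctF => e eP; have [pe le _] := eP.
have [K deK] := bound _ (continuous_left_pseudometricD dP eP).
(* [K + C] bounds d(x, h x) <= d(x, y) + d(y, h x) for the point [h * x] chosen below. *)
have : coarse_restrict (pdist_coarse d) [set` H]
    [set p | [/\ p.1 \in H, p.2 \in H & d p.1 p.2 <= K + C]%R].
  split; last by case=> x y [].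
  by apply/pdist_coarseP; exists (K + C)%R => x y [].
move=> /dH[/(_ e eP)/pdist_coarseP[M eM] _].
apply/pdist_coarseP; exists (M + K)%R => x y [/deK[h hH hK] /= dxy].
(* Since both terms are nonnegative, the bound [K] on the sum holds for each. *)
have d0 := pdist_ge0 pd (h * x)%g y; have e0 := pdist_ge0 pe (h * x)%g y.
(* By normality [h ^ x] lies in [H]; left invariance turns the pair [(x, h * x)] into [(1, h ^ x)],
   to which the hypothesis on [H] applies. *)
have hx : (h * x = x * (h ^ x))%g by rewrite conjgE mulVKg.
have eM1 : (d x (h * x)%g <= K + C)%R -> (e x (h * x)%g <= M)%R.
  move=> dM; have := eM 1%g (h ^ x)%g; rewrite -(le x) mulg1 -hx; apply.
  by split=> /=; [exact: gpred1 | exact: Defs.gpredJ | rewrite -(ld x) mulg1 -hx].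
have := pdist_triangle pd x y (h * x)%g; rewrite (pdist_sym pd y) => dt.
have := pdist_triangle pe x (h * x)%g y.
suff /eM1 : (d x (h * x)%g <= K + C)%R by lra.
lra.
Qed.

End Quotient.

Theorem theorem3 (R : realType) (G : topologicalGroupType)
    (H : normalSubgroup G) (clH : closed [set` H])
    (hyp : exists d : G -> G -> R,
       continuous_left_pseudometric R d /\
       coarse_restrict (pdist_coarse d) [set` H] =
       coarse_restrict (left_coarse R G) [set` H]) :
  quotient_coarse R H = left_coarse R (quotient_group H) /\
  left_coarse R (quotient_group H) = hausdorff_coarse R H.
Proof.
split; last exact: left_coarse_quotient.
apply/seteqP; split; first exact: quotient_coarse_sub_left.
rewrite left_coarse_quotient; have [d [dP dH]] := hyp.
by apply: hausdorff_coarse_sub_quotient dP _; rewrite dH.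
Qed.
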